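(* Let $L$ be a lattice satisfying the following properties: (i) $L$ has the weak minimal join-cover refinement property; (ii) for all $a<b$ in $L$, there are a positive integer $n$ and elements $x_0,\dots,x_n\in L$ such that $a=x_0\lessdot x_1\lessdot\cdots\lessdot x_n=b$. Then $\mathrm{J}(L)=\mathrm{J}^{\mathrm c}(L)$ and the range of $\overline{\Delta}$ on $L$ generates $\mathbf{E}(\mathrm{J}(L),\vartriangleleft)$. Furthermore, if $L$ is join-semidistributive, then $\overline{\Delta}$ is separating; hence $\mathrm{Dim}\,L\cong\mathbf{E}(\mathrm{J}(L),\vartriangleleft)$.
   Context: Let $L$ be a lattice. $L$ is join-semidistributive if $x\vee y=x\vee z$ implies $x\vee y=x\vee(y\wedge z)$. Put $L^-=L\setminus\{0\}$ if $L$ has a zero element $0$, and $L^-=L$ otherwise. $\mathrm{J}(L)$ is the set of join-irreducible elements ($p\in L^-$ such that $p=x\vee y$ implies $p\in\{x,y\}$), and $\mathrm{J}^{\mathrm c}(L)$ the set of completely join-irreducible elements ($p\in L^-$ such that there is a largest element $p_*$ strictly below $p$). For $x\in L$, $\mathrm{J}(x)=\{p\in\mathrm{J}(L)\mid p\le x\}$. Write $[a,b]\nearrow[c,d]$ (for $a\le b$, $c\le d$) if $a=b\wedge c$ and $d=b\vee c$. Write $a\lessdot b$ if $a\le b$ and there is $p\in\mathrm{J}^{\mathrm c}(L)$ with $[p_*,p]\nearrow[a,b]$. Join-covers: for $a\in L^-$, a join-cover of $a$ is a nonempty finite $X\subseteq L^-$ with $a\le\bigvee X$; it is nontrivial if no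 $x\in X$ satisfies $a\le x$. $X\sqsubseteq Y$ ($X$ refines $Y$) means that every $x\in X$ is below some $y\in Y$. A nontrivial join-cover $X$ of $a$ is minimal if every nontrivial join-cover $Y$ of $a$ with $Y\sqsubseteq X$ contains $X$. $L$ has the weak minimal join-cover refinement property if for every $a\in L^-$, every nontrivial join-cover of $a$ can be refined to a minimal nontrivial join-cover of $a$. Join-dependency: for $a\in L$ and $q\in\mathrm{J}(L)$, $a\mathbin{D}q$ means that $a\ne q$ and there is $x\in L$ with $a\le q\vee x$ and $a\nleq y\vee x$ for all $y<q$. $\vartriangleleft$ (resp. $\trianglelefteq$) is the transitive (resp. reflexive and transitive) closure of $D$ on $\mathrm{J}(L)$; $[p]^{\vartriangleleft}=\{q\in\mathrm{J}(L)\mid p\vartriangleleft q\}$ and $[p]^{\trianglelefteq}=\{q\in\mathrm{J}(L)\mid p\trianglelefteq q\}$. Let $\overline{\mathbb Z}^+=\{0,1,2,\dots\}\cup\{\infty\}$ with its usual addition, and $L^{[2]}=\{(x,y)\in L\times L\mid x\le y\}$. For $p\in\mathrm{J}(L)$ define $d_p\colon L^{[2]}\to\overline{\mathbb Z}^+$ by: $d_p(x,y)=0$ if $\mathrm{J}(x)\cap[p]^{\trianglelefteq}=\mathrm{J}(y)\cap[p]^{\trianglelefteq}$; $d_p(x,y)=1$ if $p\in\mathrm{J}(y)\setminus\mathrm{J}(x)$ and $\mathrm{J}(x)\cap[p]^{\vartriangleleft}=\mathrm{J}(y)\cap[p]^{\vartriangleleft}$; $d_p(x,y)=\infty$ if $\mathrm{J}(x)\cap[p]^{\vartriangleleft}\subsetneq\mathrm{J}(y)\cap[p]^{\vartriangleleft}$.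 Put $\overline{\Delta}(x,y)=(d_p(x,y))_{p\in\mathrm{J}(L)}\in(\overline{\mathbb Z}^+)^{\mathrm{J}(L)}$. In a commutative monoid, $x\ll y$ means $x+y=y$. For a set $P$ with a transitive relation $\vartriangleleft$, $\mathbf{E}(P,\vartriangleleft)$ is the commutative monoid defined by generators $\overline p$ ($p\in P$) and relations $\overline p\ll\overline q$ whenever $p\vartriangleleft q$. $\mathbf{F}(P,\vartriangleleft)$ is the additive submonoid of $(\overline{\mathbb Z}^+)^P$ of all maps $\boldsymbol x$ such that $p\vartriangleleft q$ implies $\boldsymbol x(q)\ll\boldsymbol x(p)$. For $p\in P$, $\tilde p\in\mathbf{F}(P,\vartriangleleft)$ is given by $\tilde p(q)=\infty$ if $q\vartriangleleft p$, $\tilde p(q)=1$ if $q=p$ and $p\not\vartriangleleft p$, and $\tilde p(q)=0$ otherwise. It is known that $\overline p\mapsto\tilde p$ extends to a monoid embedding $\mathbf{E}(P,\vartriangleleft)\hookrightarrow\mathbf{F}(P,\vartriangleleft)$, and $\mathbf{E}(P,\vartriangleleft)$ is identified with its image, i.e., with the submonoid of $(\overline{\mathbb Z}^+)^P$ generated by $\{\tilde p\mid p\in P\}$. Dimension functions: for a commutative monoid $M$, an $M$-valued dimension function on $L$ is a map $f\colon L^{[2]}\to M$ with $f(x,x)=0$; $f(x,z)=f(x,y)+f(y,z)$ for $x\le y\le z$; $f(x\wedge y,x)=f(y,x\vee y)$. It is universal if every dimension function $g\colon L^{[2]}\to N$ factors as $g=\varphi\circ f$ for a unique monoid homomorphism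 $\varphi\colon M\to N$. It is separating if its corestriction $L^{[2]}\to R(f)$ is universal, where $R(f)$ is the submonoid of $M$ generated by the range of $f$. $\mathrm{Dim}\,L$ is the target monoid of the universal dimension function on $L$ (unique up to isomorphism). *)

(* Defs.v *)
From HB Require Import structures.
From Stdlib Require Import Relation_Operators.
From mathcomp Require Import all_boot all_order all_algebra.
From mathcomp Require Import boolp classical_sets functions cardinality.

Set Implicit Arguments.
Unset Strict Implicit.
Unset Printing Implicit Defensive.

Import Order.TTheory GRing.Theory.

Local Open Scope classical_set_scope.
Local Open Scope order_scope.

Section Lattice.
Context {d : Order.disp_t} (L : latticeType d).

Definition join_semidistributive : Prop :=
  forall x y z : L, x `|` y = x `|` z -> x `|` y = x `|` (y `&` z).

(* L^- : the elements that are not a zero (that is, a least element) of L. *)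
Definition Lminus : set L := [set a | ~ (forall x : L, a <= x)].

Definition J : set L :=
  [set p | Lminus p /\ forall x y, p = x `|` y -> p = x \/ p = y].

(* s = p_* : s is the largest element strictly below p. *)
Definition is_lower_star (p s : L) : Prop :=
  s < p /\ forall x, x < p -> x <= s.

Definition Jc : set L := [set p | Lminus p /\ exists s, is_lower_star p s].

(* [a,b] transposes up to [c,d]; only used when a <= b and c <= d. *)
Definition transposes_up (a b c d : L) : Prop := a = b `&` c /\ d = b `|` c.

Definition lessdot (a b : L) : Prop :=
  a <= b /\
  exists p s, [/\ Jc p, is_lower_star p s & transposes_up s p a b].

(* A nonempty finite subset of a lattice has exactly one element in its
   [supremums]. *)
Definition join_cover (a : L) (X : set L) : Prop :=
  [/\ X !=set0, finite_set X, X `<=` Lminus &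
      exists2 s, supremums X s & a <= s].

Definition nontrivial_join_cover (a : L) (X : set L) : Prop :=
  join_cover a X /\ forall x, X x -> ~ (a <= x).

Definition refines (X Y : set L) : Prop :=
  forall x, X x -> exists2 y, Y y & x <= y.

Definition minimal_join_cover (a : L) (X : set L) : Prop :=
  nontrivial_join_cover a X /\
  forall Y, nontrivial_join_cover a Y -> refines Y X -> X `<=` Y.

Definition weak_minimal_join_cover_refinement : Prop :=
  forall a, Lminus a -> forall X, nontrivial_join_cover a X ->
  exists2 Y, minimal_join_cover a Y & refines Y X.

Definition join_dep (a : L) (q : J) : Prop :=
  a <> val q /\
  exists x, a <= val q `|` x /\ forall y, y < val q -> ~ (a <= y `|` x).

Definition tlt : J -> J -> Prop :=
  clos_trans J (fun p q => join_dep (val p) q).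

Definition tle : J -> J -> Prop :=
  clos_refl_trans J (fun p q => join_dep (val p) q).

(* [p]^{<|}, [p]^{<|=} and J(x), all as subsets of J(L) *)
Definition tlt_class (p : J) : set J := [set q | tlt p q].
Definition tle_class (p : J) : set J := [set q | tle p q].
Definition J_below (x : L) : set J := [set p | val p <= x].

Definition interval2 := {xy : L * L | xy.1 <= xy.2}.

Definition mk2 (x y : L) (xy : x <= y) : interval2 := exist _ (x, y) xy.

HB.instance Definition _ := Choice.on interval2.

Definition dimension_function (M : nmodType) (f : interval2 -> M) : Prop :=
  [/\ forall x, f (mk2 (lexx x)) = 0%R,
      forall x y z (xy : x <= y) (yz : y <= z),
        f (mk2 (le_trans xy yz)) = (f (mk2 xy) + f (mk2 yz))%R &
      forall x y, f (mk2 (leIl x y)) = f (mk2 (leUr y x))].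

Definition universal_dimension_function (M : nmodType)
    (f : interval2 -> M) : Prop :=
  dimension_function f /\
  forall (N : nmodType) (g : interval2 -> N), dimension_function g ->
  exists! phi : M -> N, nmod_morphism phi /\ g = phi \o f.

End Lattice.

Arguments Lminus {d} L _.
Arguments J {d} L _.
Arguments Jc {d} L _.

Section Submonoid.
Variable M : nmodType.
Implicit Types A S : set M.

Definition submonoid S : Prop :=
  S 0%R /\ forall x y, S x -> S y -> S (x + y)%R.

Definition generated A : set M := smallest submonoid A.

Lemma submonoid_generated A : submonoid (generated A).
Proof.
split=> [S [[S0 _] _] //|x y Ax Ay S [[S0 SD] AS]].
by apply: (SD); [apply: (Ax S)|apply: (Ay S)]; do ?split.
Qed.

Lemma sub_generated A : A `<=` generated A.
Proof. exact: sub_gen_smallest. Qed.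

Definition in_generated A : pred M := fun x => x \in generated A.

Definition generated_type A := {x : M | in_generated A x}.

HB.instance Definition _ A := SubChoice.on (generated_type A).

Fact generated_nmod_closed A : GRing.nmod_closed (in_generated A).
Proof.
have [S0 SD] := submonoid_generated A; split; first exact/mem_set.
move=> x y /set_mem Ax /set_mem Ay; apply/mem_set; exact: SD.
Qed.

HB.instance Definition _ A :=
  GRing.SubChoice_isSubNmodule.Build M (in_generated A) (generated_type A)
    (generated_nmod_closed A).

Definition corestriction (T : Type) (f : T -> M) :
    T -> generated_type (range f) :=
  fun t => exist _ (f t) (mem_set (sub_generated (imageT f t))).

End Submonoid.

Definition separating d (L : latticeType d) (M : nmodType)
    (f : interval2 L -> M) : Prop :=
  universal_dimension_function (corestriction f).

Definition nmod_isomorphic (M N : nmodType) : Prop :=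
  exists phi : M -> N, nmod_morphism phi /\ bijective phi.

Section Presented.
Variables (G : choiceType) (R : seq G -> seq G -> Prop).

(* A word [:: g1; ...; gn] stands for g1 + ... + gn, and R u v for the
   relation u = v. *)
Inductive pres_cong : seq G -> seq G -> Prop :=
| pres_rel u v : R u v -> pres_cong u v
| pres_comm u v : pres_cong (u ++ v) (v ++ u)
| pres_cat u u' v v' :
    pres_cong u u' -> pres_cong v v' -> pres_cong (u ++ v) (u' ++ v')
| pres_refl u : pres_cong u u
| pres_sym u v : pres_cong u v -> pres_cong v u
| pres_trans u v w : pres_cong u v -> pres_cong v w -> pres_cong u w.

Definition pres_congb : rel (seq G) := fun u v => `[< pres_cong u v >].

Fact pres_congb_refl : reflexive pres_congb.
Proof. by move=> u; apply/asboolP/pres_refl. Qed.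
Fact pres_congb_sym : symmetric pres_congb.
Proof. by move=> u v; apply/asboolP/asboolP => /pres_sym. Qed.
Fact pres_congb_trans : transitive pres_congb.
Proof.
by move=> v u w /asboolP uv /asboolP vw; apply/asboolP/(pres_trans uv vw).
Qed.

Canonical pres_equiv :=
  EquivRel pres_congb pres_congb_refl pres_congb_sym pres_congb_trans.

Definition presented := {eq_quot pres_equiv}%qT.

HB.instance Definition _ := Choice.on presented.
HB.instance Definition _ := EqQuotient.on presented.

Definition pres_class (u : seq G) : presented := (\pi_presented u)%qT.

Definition pres_gen (g : G) : presented := pres_class [:: g].

Lemma pres_classP u v : pres_class u = pres_class v <-> pres_cong u v.
Proof. by split=> [/eqmodP/asboolP|uv] //; apply/eqmodP/asboolP. Qed.

Lemma pres_classK x : pres_class (repr x)%qT = x.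
Proof. exact: reprK. Qed.

Definition pres_add (x y : presented) : presented :=
  pres_class (repr x ++ repr y)%qT.

Lemma pres_addE u v :
  pres_add (pres_class u) (pres_class v) = pres_class (u ++ v).
Proof.
by apply/pres_classP/pres_cat; apply/pres_classP; rewrite pres_classK.
Qed.

Fact pres_addA : associative pres_add.
Proof.
move=> x y z; rewrite -[x]pres_classK -[y]pres_classK -[z]pres_classK.
by rewrite !pres_addE catA.
Qed.
Fact pres_addC : commutative pres_add.
Proof. by move=> x y; apply/pres_classP/pres_comm. Qed.
Fact pres_add0 : left_id (pres_class [::]) pres_add.
Proof. by move=> x; rewrite -[x]pres_classK pres_addE. Qed.

HB.instance Definition _ :=
  GRing.isNmodule.Build presented pres_addA pres_addC pres_add0.

Lemma pres_classE u : pres_class u = (\sum_(g <- u) pres_gen g)%R.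
Proof.
elim: u => [|g u IH]; first by rewrite big_nil.
by rewrite big_cons -IH [RHS]pres_addE.
Qed.

Lemma pres_relE u v : R u v -> pres_class u = pres_class v.
Proof. by move=> Ruv; apply/pres_classP/pres_rel. Qed.

Lemma pres_universal (N : nmodType) (h : G -> N) :
  (forall u v, R u v -> (\sum_(g <- u) h g = \sum_(g <- v) h g)%R) ->
  exists! phi : presented -> N, nmod_morphism phi /\ h = phi \o pres_gen.
Proof.
move=> hR.
have hcong u v : pres_cong u v -> (\sum_(g <- u) h g = \sum_(g <- v) h g)%R.
  elim=> {u v} [u v /hR //|u v|u u' v v' _ + _|//|//|u v w _ -> _ //].
    by rewrite !big_cat; apply: addrC.
  by move=> uu' vv'; rewrite !big_cat /= uu' vv'.
pose phi (x : presented) : N := (\sum_(g <- repr x) h g)%R.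
have phiE u : phi (pres_class u) = (\sum_(g <- u) h g)%R.
  by apply/hcong/pres_classP; rewrite pres_classK.
exists phi; split=> [|psi [[psi0 psiD] hE]].
  split; last by apply/funext => g /=; rewrite phiE big_seq1.
  split=> [|x y]; first by rewrite [LHS](phiE [::]) big_nil.
  rewrite -[x]pres_classK -[y]pres_classK [X in phi X]pres_addE !phiE.
  by rewrite big_cat.
apply/funext => x; rewrite -[x]pres_classK phiE pres_classE.
elim: (repr x)%qT => [|g u IH]; first by rewrite !big_nil psi0.
by rewrite !big_cons psiD IH hE.
Qed.

End Presented.

Section Dim.
Context {d : Order.disp_t} (L : latticeType d).

Inductive dim_rel : seq (interval2 L) -> seq (interval2 L) -> Prop :=
| dim_rel0 x : dim_rel [:: mk2 (lexx x)] [::]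
| dim_relD x y z (xy : x <= y) (yz : y <= z) :
    dim_rel [:: mk2 (le_trans xy yz)] [:: mk2 xy; mk2 yz]
| dim_relIU x y : dim_rel [:: mk2 (leIl x y)] [:: mk2 (leUr y x)].

Definition Dim : nmodType := presented dim_rel.

Definition Dim_gen : interval2 L -> Dim := @pres_gen _ dim_rel.

Lemma Dim_universal : universal_dimension_function Dim_gen.
Proof.
split=> [|N g [g0 gD gIU]].
  split=> [x|x y z xy yz|x y].
  - exact: pres_relE (dim_rel0 x).
  - by rewrite [RHS]pres_addE; apply: pres_relE (dim_relD xy yz).
  - exact: pres_relE (dim_relIU x y).
apply: pres_universal => _ _ [x|x y z xy yz|x y].
- by rewrite unlock /= g0 addr0.
- by rewrite unlock /= gD !addr0.
- by rewrite unlock /= gIU.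
Qed.

End Dim.

(* [Some n] is n and [None] is infinity. *)
Definition enat := option nat.

HB.instance Definition _ := Choice.on enat.

Definition einf : enat := None.
Definition efin (n : nat) : enat := Some n.

Definition enat_add (m n : enat) : enat :=
  if m is Some i then if n is Some j then efin (i + j) else einf else einf.

Fact enat_addA : associative enat_add.
Proof. by move=> [i|] [j|] [k|] //=; rewrite /efin addnA. Qed.
Fact enat_addC : commutative enat_add.
Proof. by move=> [i|] [j|] //=; rewrite /efin addnC. Qed.
Fact enat_add0 : left_id (efin 0) enat_add.
Proof. by case. Qed.

HB.instance Definition _ :=
  GRing.isNmodule.Build enat enat_addA enat_addC enat_add0.

Section E.
Variables (P : choiceType) (lt : P -> P -> Prop).

(* p << q, i.e. p + q = q, whenever p <| q *)
Inductive E_rel : seq P -> seq P -> Prop :=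
| E_rel_ll p q : lt p q -> E_rel [:: p; q] [:: q].

Definition E : nmodType := presented E_rel.

Definition tilde (p : P) : P -> enat := fun q =>
  if `[< lt q p >] then einf
  else if `[< q = p /\ ~ lt p p >] then efin 1 else efin 0.

(* The copy of E(P, <|) inside the monoid of all maps P -> enat *)
Definition E_image : set (P -> enat) := generated (range tilde).

End E.

Section Delta.
Local Open Scope classical_set_scope.
Context {d : Order.disp_t} (L : latticeType d).
Implicit Types (p : J L) (xy : interval2 L).

(* The third case, with value infinity, is the only one left: see dp_cases. *)
Definition dp p xy : enat :=
  let x := (val xy).1 in let y := (val xy).2 in
  if `[< J_below x `&` tle_class p = J_below y `&` tle_class p >] then efin 0
  else if `[< (J_below y `\` J_below x) p /\
              J_below x `&` tlt_class p = J_below y `&` tlt_class p >]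
  then efin 1
  else einf.

Lemma tleE p q : tle p q <-> p = q \/ tlt p q.
Proof.
split=> [|[->|]]; last 1 first.
- elim=> [r s rs|r s t _ rs _ st]; first exact: rt_step.
  exact: rt_trans rs st.
- elim=> [r s rs|r|r s t _ [->|rs] _ [<-|st]]; try by [left|right].
    by right; apply: t_step.
  by right; apply: t_trans rs st.
- exact: rt_refl.
Qed.

Section Cases.
Variables (p : J L) (x y : L) (xy : x <= y).

Lemma dp0 : J_below x `&` tle_class p = J_below y `&` tle_class p ->
  dp p (mk2 xy) = efin 0.
Proof. by move=> h; rewrite /dp /=; case: asboolP. Qed.

Lemma dp1 : (J_below y `\` J_below x) p ->
    J_below x `&` tlt_class p = J_below y `&` tlt_class p ->
  dp p (mk2 xy) = efin 1.
Proof.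
move=> [yp xp] h; rewrite /dp /=; case: asboolP => [e|_].
  suff: (J_below x `&` tle_class p) p by case.
  by rewrite e; split=> //; apply: rt_refl.
by case: asboolP => // -[].
Qed.

Lemma dpoo : J_below x `&` tlt_class p `<` J_below y `&` tlt_class p ->
  dp p (mk2 xy) = einf.
Proof.
move=> lt; rewrite /dp /=; case: asboolP => [e|_].
  case: lt => _ []; move=> q [yq pq].
  have: (J_below x `&` tle_class p) q.
    by rewrite e; split=> //; apply/tleE; right.
  by case.
by case: asboolP => // -[_ e]; move: lt; rewrite e => -[_ []].
Qed.

Lemma dp_cases :
  [\/ J_below x `&` tle_class p = J_below y `&` tle_class p,
      (J_below y `\` J_below x) p /\
      J_below x `&` tlt_class p = J_below y `&` tlt_class p |
      J_below x `&` tlt_class p `<` J_below y `&` tlt_class p].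
Proof.
have xyJ q : J_below x q -> J_below y q by move=> /le_trans; apply.
have sub : J_below x `&` tlt_class p `<=` J_below y `&` tlt_class p.
  by move=> q [/xyJ].
have [e|ne] := pselect (J_below x `&` tlt_class p = J_below y `&` tlt_class p).
  have [yxp|nyxp] := pselect ((J_below y `\` J_below x) p).
    by apply: Or32.
  apply: Or31; apply/seteqP; split=> q [xq pq]; split=> //; first exact: xyJ.
  case/tleE: (pq) => [pq'|pq'].
    by apply: contrapT => nx; apply: nyxp; rewrite pq'.
  have: (J_below y `&` tlt_class p) q by [].
  by rewrite -e => -[].
by apply: Or33; split=> // sub'; apply: ne; apply/seteqP.
Qed.

End Cases.

Definition Delta xy : J L -> enat := fun p => dp p xy.

End Delta.

(* Main.v *)
(* By the weak minimal join-cover refinement property, if every element of a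
   D-closed set of join-irreducibles below x is below y, then so is every one
   below x \/ y; hence Delta is a dimension function. Its value on [p_*, p] is
   tilde p, and by the chain condition every interval is, for all dimension
   functions at once, a sum of such prime intervals. Universality then amounts
   to two facts: an equality between sums of elements tilde p follows from the
   relations p << q for p <| q, and, under join-semidistributivity, p D q forces
   f(p_*, p) << f(q_*, q) for every dimension function f. *)

Require Import Defs.
From Stdlib Require Import Relation_Operators.
From mathcomp Require Import all_boot all_order all_algebra.
From mathcomp Require Import boolp classical_sets functions cardinality.

Import Order.TTheory GRing.Theory.

Local Open Scope classical_set_scope.
Local Open Scope order_scope.

(** * Words in a generating family of a commutative monoid *)

Section Words.
Implicit Types M N : nmodType.

Lemma nmod_morphism_sum {M N} (phi : M -> N) : nmod_morphism phi ->
  forall T (a : T -> M) (u : seq T),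
    phi (\sum_(p <- u) a p)%R = (\sum_(p <- u) phi (a p))%R.
Proof. by case=> phi0 phiD T a u; apply: big_morph. Qed.

Lemma generated_words {T : Type} {M} (a : T -> M) :
  generated (range a) = range (fun u : seq T => (\sum_(p <- u) a p)%R).
Proof.
apply/seteqP; split.
  apply: smallest_sub => [|_ [p _ <-]]; last first.
    by exists [:: p]; rewrite ?big_seq1.
  split=> [|_ _ [u _ <-] [v _ <-]]; first by exists [::]; rewrite ?big_nil.
  by exists (u ++ v); rewrite ?big_cat.
have [g0 gD] := submonoid_generated (range a).
move=> _ [u _ <-]; elim: u => [|p u IH]; first by rewrite big_nil.
by rewrite big_cons; apply: gD => //; apply: sub_generated; exists p.
Qed.

(** Evaluate [b] on a chosen [a]-word of each element: the second hypothesis makes the value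
    independent of the choice, so concatenating words gives additivity. *)
Lemma word_morphism {T : Type} {M N} {a : T -> M} {b : T -> N} :
  (forall x, exists u : seq T, x = \sum_(p <- u) a p)%R ->
  (forall u v : seq T, \sum_(p <- u) a p = \sum_(p <- v) a p ->
                       \sum_(p <- u) b p = \sum_(p <- v) b p)%R ->
  exists2 phi : M -> N, nmod_morphism phi & forall p, phi (a p) = b p.
Proof.
move=> /choice[w wE] ab; exists (fun x => \sum_(p <- w x) b p)%R.
  split=> [|x y]; first by rewrite (ab _ [::]) ?big_nil -?wE.
  by rewrite -big_cat; apply: ab; rewrite big_cat -!wE.
by move=> p; rewrite -[RHS](big_seq1 +%R p b); apply: ab; rewrite -wE big_seq1.
Qed.

Lemma word_isomorphism {T : Type} {M N} {a : T -> M} {b : T -> N} :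
  (forall x, exists u : seq T, x = \sum_(p <- u) a p)%R ->
  (forall y, exists u : seq T, y = \sum_(p <- u) b p)%R ->
  (forall u v : seq T, \sum_(p <- u) a p = \sum_(p <- v) a p <->
                       \sum_(p <- u) b p = \sum_(p <- v) b p)%R ->
  nmod_isomorphic M N.
Proof.
move=> aM bN ab.
have [phi phiM phiE] := word_morphism aM (fun u v => proj1 (ab u v)).
have [psi psiM psiE] := word_morphism bN (fun u v => proj2 (ab u v)).
exists phi; split=> //; exists psi => [x|y].
  have [u ->] := aM x; rewrite !nmod_morphism_sum //.
  by under eq_bigr do rewrite phiE psiE.
have [u ->] := bN y; rewrite !nmod_morphism_sum //.
by under eq_bigr do rewrite psiE phiE.
Qed.

End Words.

(** * Sums of the maps [tilde p] *)

Section Tilde.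
Context {P : choiceType} {lt : P -> P -> Prop}.
Implicit Types (p q : P) (u v : seq P).

(** Infinity absorbs everything in [enat], so a single [p] in [u] with [lt q p] decides the value.
    Otherwise only the occurrences of [q] count, and for these [~ lt q q] holds because the first
    case fails. *)
Lemma sum_tildeE u q : (\sum_(p <- u) tilde lt p q)%R =
  if `[< exists2 p, p \in u & lt q p >] then einf else efin (count_mem q u).
Proof.
elim: u => [|p u IH]; first by rewrite big_nil asboolF // => -[].
rewrite big_cons {}IH /tilde; case: (asboolP (lt q p)) => [qp|nqp].
  by rewrite (asboolT (ex_intro2 _ _ p (mem_head _ _) qp)).
case: (asboolP (exists2 r, r \in u & _)) => [[r ru qr]|nu].
  have rpu : r \in p :: u by rewrite in_cons ru orbT.
  by rewrite [LHS]addrC (asboolT (ex_intro2 _ _ r rpu qr)).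
have npu : ~ exists2 r, r \in p :: u & lt q r.
  by case=> r /[!in_cons]/orP[/eqP->//|ru] qr; apply: nu; exists r.
rewrite (asboolF npu); case: (asboolP (q = p /\ _)) => [[-> _]|ne] /=.
  by rewrite eqxx.
by case: eqP => [pq|//]; case: ne; rewrite -pq in nqp *.
Qed.

Context {N : nmodType} {h : P -> N}.
Hypothesis h_absorb : forall p q, lt p q -> (h p + h q = h q)%R.

(* The generators at which the sum of the [tilde p] is infinite are absorbed by
   the word, and the multiplicities of the others can be read off the sum. *)
Lemma tilde_word_inj u v :
  (\sum_(p <- u) tilde lt p = \sum_(p <- v) tilde lt p)%R ->
  (\sum_(p <- u) h p = \sum_(p <- v) h p)%R.
Proof.
move=> uv.
pose f u q : enat := (\sum_(p <- u) tilde lt p q)%R.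
have fuv q : f u q = f v q.
  by have := congr1 (@^~ q) uv; rewrite !fct_sumE.
pose fine q := f u q != einf.
have absorb w q : f w q = einf ->
    (h q + \sum_(p <- w) h p = \sum_(p <- w) h p)%R.
  rewrite /f sum_tildeE; case: asboolP => // -[r rw qr] _.
  by rewrite (big_rem r) //= addrA h_absorb.
have split_word w : (\sum_(p <- w) h p = \sum_(p <- w | fine p) h p +
    \sum_(p <- w | ~~ fine p) h p)%R by exact: bigID.
have absorb_word w w' : (forall q, f w q = f u q) ->
    (\sum_(p <- w' | ~~ fine p) h p + \sum_(p <- w) h p = \sum_(p <- w) h p)%R.
  move=> wu; elim: w' => [|q w' IH]; first by rewrite big_nil add0r.
  rewrite big_cons; case: ifP => // /negbNE/eqP quE.
  by rewrite -addrA IH absorb // wu.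
have fineE : (\sum_(p <- u | fine p) h p = \sum_(p <- v | fine p) h p)%R.
  rewrite -!(big_filter _ fine); apply: perm_big; apply/allP => q _ /=.
  rewrite !count_filter; case fq: (fine q); last first.
    rewrite !(@eq_count _ _ pred0) ?count_pred0 // => p /=.
      by case: eqP => // ->.
    by case: eqP => // ->.
  have e w : count (predI (pred1 q) fine) w = count_mem q w.
    by apply: eq_count => p /=; case: eqP => // ->.
  have := fuv q; rewrite !e; move: fq; rewrite /fine /f !sum_tildeE.
  by case: asboolP => [_ /eqP//|_ _]; case: asboolP => // _ [->].
rewrite -(absorb_word u v) // -[RHS](absorb_word v u) //.
rewrite (split_word u) (split_word v) fineE addrCA [RHS]addrCA.
by rewrite [X in (_ + X)%R]addrC.
Qed.

End Tilde.

(** * Minimal join-covers and join-dependency *)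

Section Cover.
Context {d : Order.disp_t} {L : latticeType d}.
Implicit Types (x y z s : L) (I X Z : set L).

Lemma finite_supremum X : X !=set0 -> finite_set X -> exists s, supremums X s.
Proof.
move=> X0 /finite_seqP[u XE]; move: X0; rewrite {}XE.
elim: u => [[]//|x [|y u] IH _].
  exists x; split=> [z /=|s]; first by rewrite inE => /eqP->.
  by apply; rewrite /= mem_head.
have [|s [us ls]] := IH; first by exists y; rewrite /= mem_head.
exists (x `|` s); split=> [z /= |t ut].
  rewrite in_cons => /orP[/eqP->|/us/le_trans]; first exact: leUl.
  by apply; exact: leUr.
rewrite leUx ut /=; last by rewrite mem_head.
by apply: ls => z /= zu; apply: ut; rewrite /= in_cons [X in _ || X]zu orbT.
Qed.

(** Otherwise the set with [r] replaced by [Z] would be a nontrivial join-cover of [q] refining [I];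
    by minimality it would contain [r], which has been removed and is not in [Z]. Speaking of upper
    bounds allows the new set to be empty. *)
Lemma minimal_join_cover_replace q I r Z :
  minimal_join_cover q I -> I r -> finite_set Z -> Z `<=` Lminus L ->
  (forall z, Z z -> z < r) ->
  exists2 s, ubound (I `\ r `|` Z) s & ~ (q <= s).
Proof.
move=> [[[I0 Ifin IL _] Int] Imin] Ir Zfin ZL Zr; apply: contrapT => noub.
have covers s : ubound (I `\ r `|` Z) s -> q <= s.
  by move=> us; apply: contrapT => qs; apply: noub; exists s.
have [Y0|/set0P Y0] := eqVneq (I `\ r `|` Z)%classic set0.
  by apply: (Int r Ir); apply: covers => x; rewrite Y0.
have Yfin : finite_set (I `\ r `|` Z).
  by rewrite finite_setU; split=> //; apply: finite_setD.
have [s sY] := finite_supremum _ Y0 Yfin.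
have : (I `\ r `|` Z)%classic r.
  apply: (Imin _ _ _ _ Ir).
    split=> [|x [[Ix _]|Zx] qx]; last 2 first.
    - exact: Int qx.
    - by apply: (Int r Ir); apply: le_trans qx (ltW (Zr _ Zx)).
    split=> // [x [[/IL]|/ZL]//|]; exists s => //.
    by apply: covers; case: sY.
  move=> x [[Ix _]|Zx]; first by exists x.
  by exists r => //; apply/ltW/Zr.
by case=> [[_]|/Zr]; [apply|rewrite ltxx].
Qed.

(** If [r] were the join of strictly smaller [u] and [v], then after replacing [r] by [u] and [v]
    every upper bound would still be above the join of [I], hence above [q]. *)
Lemma minimal_join_cover_J q I r :
  minimal_join_cover q I -> I r -> J L r.
Proof.
move=> minI Ir; have [[[I0 Ifin IL [s [us ls] qs]] Int] _] := minI.
split=> [|u v ruv]; first exact: IL.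
apply: contrapT => /not_orP[ru rv].
have ur : u < r by rewrite lt_neqAle ruv leUl andbT -ruv; apply/eqP => /esym.
have vr : v < r by rewrite lt_neqAle ruv leUr andbT -ruv; apply/eqP => /esym.
have uvL : [set u; v] `<=` Lminus L.
  move=> _ [->|->] mn; first by apply: rv; rewrite ruv join_r // mn.
  by apply: ru; rewrite ruv join_l // mn.
have uvr z : [set u; v] z -> z < r by case=> ->.
have [t tub []] :=
  minimal_join_cover_replace _ _ _ _ minI Ir (finite_set2 u v) uvL uvr.
apply: le_trans qs _; apply: ls => x Ix.
have [->|xr] := eqVneq x r; last by apply: tub; left; split=> //; apply/eqP.
by rewrite ruv leUx !tub //; right; [right|left].
Qed.

Lemma minimal_join_cover_dep q I (r : J L) :
  minimal_join_cover q I -> I (val r) -> join_dep q r.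
Proof.
move=> minI Ir; have [[[I0 Ifin IL [s [us ls] qs]] Int] _] := minI.
split=> [qr|]; first by apply: (Int _ Ir); rewrite qr.
(* The witness for [join_dep] is the join of the other elements of [I]; there are some, since [I]
   reduced to [r] would give [q <= r]. *)
have [t []] : exists t, supremums (I `\ val r) t.
  apply: finite_supremum; last exact: finite_setD.
  apply: contrapT => I1; apply: (Int _ Ir); apply: le_trans qs _.
  apply: ls => x Ix; have [->//|xr] := eqVneq x (val r).
  by case: I1; exists x; split=> //; apply/eqP.
move=> ut lt; exists t; split=> [|y yr qyt].
  apply: le_trans qs _; apply: ls => x Ix.
  have [->|xr] := eqVneq x (val r); first exact: leUl.
  apply: le_trans (leUr _ _); apply: ut; split=> //; exact/eqP.
(* Replace [r] by [y], or by nothing if [y] is zero, since covers avoid zero. *)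
pose Z := [set z | z = y /\ Lminus L z].
have [|z []|z [->]//|s' us' []] :=
    minimal_join_cover_replace q I (val r) Z minI Ir => //.
  by apply: (@sub_finite_set _ _ [set y]) => // z [].
apply: le_trans qyt _; rewrite leUx; apply/andP; split.
  have [yL|nyL] := pselect (Lminus L y); first by apply: us'; right.
  by move/contrapT: nyL; apply.
by apply: lt => x Ix; apply: us'; left.
Qed.

(* Every element of a minimal join-cover refining [{x, y}] lies in the same
   D-closed set and below [x] or [y]. *)
Lemma dep_closed_leU (S : set (J L)) x y :
  weak_minimal_join_cover_refinement L ->
  (forall p q : J L, S p -> join_dep (val p) q -> S q) ->
  (forall q : J L, S q -> val q <= x -> val q <= y) ->
  forall q : J L, S q -> val q <= x `|` y -> val q <= y.
Proof.
move=> hcover Scl Sxy q Sq qxy; apply: contrapT => nqy.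
have nqx : ~ (val q <= x) by move=> /(Sxy _ Sq).
have qL : Lminus L (val q) by have /set_mem[] := valP q.
have xyU : supremums [set x; y] (x `|` y).
  split=> [_ [->|->]|s us]; rewrite ?leUl ?leUr //.
  by rewrite leUx !us //; [right|left].
have [|I minI Ixy] := hcover _ qL [set x; y].
  split=> [|_ [->|->] //]; split; first by exists x; left.
  - exact: finite_set2.
  - move=> _ [->|->] mn; first by apply: nqy; rewrite join_r ?mn in qxy.
    by apply: nqx; rewrite join_l ?mn in qxy.
  - by exists (x `|` y).
have [[[_ _ _ [s [_ ls] qs]] _] _] := minI.
apply/nqy/(le_trans qs)/ls => r Ir.
have rJ := minimal_join_cover_J _ _ _ minI Ir.
pose r' : J L := SigSub (mem_set rJ).
have Sr : S r' by apply: (Scl q) => //; apply: minimal_join_cover_dep minI _.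
by have [_ [->|->] //] := Ixy _ Ir; apply: (Sxy r').
Qed.

End Cover.

(** * [Delta] as a dimension function *)

Section DeltaDimension.
Context {d : Order.disp_t} {L : latticeType d}.
Implicit Types (x y z : L) (p q r : J L).

(** As [x <= y], one inclusion suffices for the traces on [tlt_class p] to agree; outside that class
    [tle_class p] can contain only [p], which then decides between 0 and 1. *)
Lemma dpE p {x y} (xy : x <= y) : dp p (mk2 xy) =
  if `[< forall q, tlt p q -> val q <= y -> val q <= x >]
  then efin ((val p <= y) && ~~ (val p <= x)) else einf.
Proof.
have agree : (J_below x `&` tlt_class p = J_below y `&` tlt_class p)%classic ->
    forall q, tlt p q -> val q <= y -> val q <= x.
  move=> e q pq qy; have: (J_below y `&` tlt_class p)%classic q by [].
  by rewrite -e => -[].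
have [e|[[/= py npx] e]|lt] := dp_cases p xy.
- rewrite dp0 // asboolT => [|q pq qy]; last first.
    have: (J_below y `&` tle_class p)%classic q.
      by split=> //; apply/tleE; right.
    by rewrite -e => -[].
  case py: (val p <= y) => //=; suff -> : val p <= x by [].
  have: (J_below y `&` tle_class p)%classic p by split=> //; exact: rt_refl.
  by rewrite -e => -[].
- rewrite dp1 // asboolT; last exact: agree.
  by have -> : val p <= y by []; move/negP: npx => ->.
- rewrite dpoo // asboolF // => sub; case: lt => _ []; move=> q [yq pq].
  by split=> //; apply: sub.
Qed.

Lemma dp_additive p {x y z} (xy : x <= y) (yz : y <= z) :
  dp p (mk2 (le_trans xy yz)) = (dp p (mk2 xy) + dp p (mk2 yz))%R.
Proof.
rewrite !dpE; case: (asboolP (forall q, _ -> val q <= y -> _)) => [syx|nsyx].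
  case: (asboolP (forall q, _ -> val q <= z -> val q <= y)) => [szy|nszy].
    rewrite asboolT => [|q pq /(szy _ pq)/(syx _ pq) //].
    congr efin; case py: (val p <= y) => /=.
      by rewrite (le_trans py yz) addn0.
    rewrite andbT; case px: (val p <= x); last by rewrite andbT.
    by rewrite (le_trans px xy) in py.
  rewrite asboolF // => szx; apply: nszy => q pq /(szx _ pq) qx.
  exact: le_trans qx xy.
rewrite asboolF // => szx; apply: nsyx => q pq qy.
by apply: szx; rewrite // (le_trans qy).
Qed.

Lemma dp_transpose p x y : weak_minimal_join_cover_refinement L ->
  dp p (mk2 (leIl x y)) = dp p (mk2 (leUr y x)).
Proof.
move=> hcover; rewrite !dpE.
have tlt_closed q r : tlt_class p q -> join_dep (val q) r -> tlt_class p r.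
  by move=> pq qr; apply: t_trans pq (t_step _ _ _ _ qr).
(* The two values are infinite together: [tlt_class p] is D-closed, so if its members below [x] are
   below [y], then so are those below the join. *)
have -> : `[< forall q, tlt p q -> val q <= x -> val q <= x `&` y >] =
          `[< forall q, tlt p q -> val q <= x `|` y -> val q <= y >].
  apply: asbool_equiv_eq; split=> sub q pq qx; last first.
    by rewrite lexI qx sub // (le_trans qx) // leUl.
  apply: (dep_closed_leU (tlt_class p) x) => // r pr rx.
  by have := sub r pr rx; rewrite lexI => /andP[].
case: asboolP => // sub; congr efin; rewrite lexI.
case py: (val p <= y); first by rewrite andbT andbN andbF.
rewrite andbF andbT /=; case px: (val p <= x) => /=.
  by rewrite (le_trans px) ?leUl.
case: (boolP (val p <= x `|` y)) => // pxy.
(* Now the D-closed set is [tle_class p]: at [p] the required implication is vacuous because [p] is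
   not below [x], and on the rest it follows from [sub]. *)
suff : val p <= y by rewrite py.
apply: (dep_closed_leU (tle_class p) x) => //; last exact: rt_refl.
  by move=> q r pq qr; apply: rt_trans pq (rt_step _ _ _ _ qr).
move=> q /tleE[<-|pq] qx; first by rewrite qx in px.
by apply: sub => //; rewrite (le_trans qx) ?leUl.
Qed.

Lemma Delta_dimension_function : weak_minimal_join_cover_refinement L ->
  dimension_function (@Delta d L).
Proof.
move=> hcover; split=> [x|x y z xy yz|x y]; apply/funext => p.
- by rewrite /Delta dp0.
- exact: dp_additive.
- exact: dp_transpose.
Qed.

(** The only join-irreducible element below [p] but not below [s] is [p] itself, so [dp q] is
    infinite exactly when [p] lies in [tlt_class q]. *)
Lemma Delta_lower_star p s (sp : s <= val p) :
  is_lower_star (val p) s -> Delta (mk2 sp) = tilde (@tlt d L) p.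
Proof.
move=> [ltsp sP]; apply/funext => q; rewrite /Delta dpE /tilde.
have nps : (val p <= s) = false by rewrite (lt_geF ltsp).
case: (asboolP (tlt q p)) => [qp|nqp].
  by rewrite asboolF // => /(_ p qp (lexx _)); rewrite nps.
rewrite asboolT => [|r qr rp]; last first.
  apply: sP; rewrite lt_neqAle rp andbT; apply: contra_notN nqp => /eqP rpE.
  by rewrite -(val_inj rpE).
case: (eqVneq q p) nqp => [->|qp] nqp; first by rewrite lexx nps asboolT.
rewrite asboolF => [|[/eqP]]; last by rewrite (negbTE qp).
congr efin; case: (boolP (val q <= val p)) => [qp'|//].
rewrite sP // lt_neqAle qp' andbT.
by apply: contra_neq qp => qpE; rewrite (val_inj qpE).
Qed.

End DeltaDimension.

(** * Arbitrary dimension functions and join-dependency *)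

Section DimensionFunctions.
Context {d : Order.disp_t} {L : latticeType d}.
Implicit Types (a b x y z s : L) (p q : J L).

(** A total version of [f], so that endpoints can be rewritten without carrying proofs of [x <= y];
    the value 0 elsewhere is arbitrary. *)
Definition value {M : nmodType} (f : interval2 L -> M) x y : M :=
  if @idP (x <= y) is ReflectT xy then f (mk2 xy) else 0%R.

Lemma valueE {M : nmodType} (f : interval2 L -> M) {x y} (xy : x <= y) :
  value f x y = f (mk2 xy).
Proof.
rewrite /value; case: {-}_ / idP => [xy'|//].
by congr (f (mk2 _)); apply: bool_irrelevance.
Qed.

Section Value.
Context {M : nmodType} {f : interval2 L -> M}.
Hypothesis f_dim : dimension_function f.

Lemma value_refl x : value f x x = 0%R.
Proof. by have [f0 _ _] := f_dim; rewrite (valueE f (lexx x)). Qed.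

Lemma value_add x y z : x <= y -> y <= z ->
  value f x z = (value f x y + value f y z)%R.
Proof.
have [_ fD _] := f_dim => xy yz.
by rewrite (valueE f (le_trans xy yz)) fD -!valueE.
Qed.

Lemma value_transpose x y : value f (x `&` y) x = value f y (x `|` y).
Proof.
by have [_ _ fIU] := f_dim; rewrite (valueE f (leIl x y)) fIU -valueE.
Qed.

(* Put a = sq \/ x, so that [sq, q] transposes up to [a, b] with b = q \/ x.
   If q is not below a \/ p, then f(sq, q) absorbs f(y /\ a, y) for every
   y <= p; apply this to y = p and to y = sp. Otherwise join-semidistributivity
   gives q <= sp, and both f(p /\ a, sp) and f(p /\ a, p) equal f(sq, q). *)
Lemma value_join_dep p q sp sq : join_semidistributive L ->
  is_lower_star (val p) sp -> is_lower_star (val q) sq ->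
  join_dep (val p) q ->
  (value f sp (val p) + value f sq (val q) = value f sq (val q))%R.
Proof.
move=> hJSD [ltsp spP] [ltsq sqP] [pq [x [pqx npyx]]].
set P := val p in spP ltsp pq pqx npyx *.
set Q := val q in sqP ltsq pq pqx npyx *.
pose a := sq `|` x; pose b := Q `|` x.
have nPa : ~ (P <= a) by apply: npyx.
have bE : b = Q `|` a by rewrite joinA (join_l (ltW ltsq)).
have ab : a <= b by rewrite bE leUr.
have sqa : sq <= a by apply: leUl.
have QI y : a <= y -> ~ (Q <= y) -> Q `&` y = sq.
  move=> ay nQy; apply/le_anti; rewrite lexI (ltW ltsq) (le_trans sqa) // andbT.
  rewrite andbT; apply: sqP; rewrite lt_neqAle leIl andbT.
  by apply/eqP => QyE; apply: nQy; rewrite -QyE leIr.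
have nQa : ~ (Q <= a).
  by move=> Qa; apply: nPa; rewrite (le_trans pqx) // -/b bE leUx Qa /=.
have Qab : value f sq Q = value f a b by rewrite -(QI a) // value_transpose bE.
have aP : a `&` P <= sp.
  apply: spP; rewrite lt_neqAle leIr andbT; apply/eqP => aPE.
  by apply: nPa; rewrite -aPE leIl.
have aspE : a `&` sp = a `&` P.
  apply/le_anti; rewrite !lexI !leIl aP /= andbT.
  by rewrite (le_trans (leIr _ _)) // ltW.
have split_P : value f (a `&` P) P = (value f (a `&` P) sp + value f sp P)%R.
  by apply: value_add => //; apply: ltW.
have below y : value f (y `&` a) y = value f a (a `|` y).
  by rewrite value_transpose joinC.
have [QaP|nQaP] := pselect (Q <= a `|` P).
  have aPE : a `|` P = b.
    by apply/le_anti; rewrite leUx ab pqx bE leUx QaP leUl.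
  have QP : Q <= P.
    (* Semidistributivity turns [b = a \/ P = a \/ Q] into [b = a \/ (P /\ Q)]. If [Q] were not
       below [P], then [P /\ Q] would be below [sq], hence below [a], and so [Q <= b <= a]. *)
    have := hJSD a P Q; rewrite aPE [a `|` Q]joinC -bE => /(_ erefl) bPQ.
    apply: contrapT => nQP; apply: nQa.
    have PQ : P `&` Q <= sq.
      apply: sqP; rewrite lt_neqAle leIr andbT; apply/eqP => PQE.
      by apply: nQP; rewrite -PQE leIl.
    suff ba : b <= a by rewrite (le_trans _ ba) // bE leUl.
    by rewrite bPQ leUx lexx (le_trans PQ).
  have Qsp : Q <= sp.
    by apply: spP; rewrite lt_neqAle QP andbT; apply/eqP => /esym.
  have aspb : a `|` sp = b.
    apply/le_anti; rewrite leUx ab -{1}aPE (le_trans (ltW ltsp)) ?leUr //=.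
    by rewrite bE leUx leUl (le_trans Qsp) ?leUr.
  have QE : value f sq Q = value f (a `&` P) sp.
    by rewrite Qab -aspb -below meetC aspE.
  rewrite addrC {1}QE -split_P meetC below aPE; exact/esym.
have absorbs y : y <= P ->
    value f sq Q = (value f (y `&` a) y + value f sq Q)%R.
  move=> yP; have nQy : ~ (Q <= a `|` y).
    by move=> Qy; apply: nQaP; rewrite (le_trans Qy) // leU2.
  have yb : a `|` y <= b by rewrite leUx ab (le_trans yP).
  have byE : b = Q `|` (a `|` y).
    apply/le_anti/andP; split; last by rewrite leUx yb leUl.
    by rewrite bE leU2 // leUl.
  (* [[sq, Q]] also transposes up to [[a \/ y, b]], so splitting [[a, b]] at [a \/ y] reproduces the
     value on [[sq, Q]] next to that on [[y /\ a, y]]. *)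
  rewrite {1}Qab (value_add a (a `|` y) b) ?leUl // below; congr (_ + _)%R.
  by rewrite byE -value_transpose QI ?leUl.
rewrite [RHS](absorbs P) // [P `&` a]meetC split_P -addrA addrCA.
by congr (_ + _)%R; rewrite -aspE [a `&` sp]meetC -absorbs // ltW.
Qed.

End Value.
End DimensionFunctions.

(** * Chains of transposed prime intervals, universality of [Delta], and [Dim L] *)

Section Chains.
Context {d : Order.disp_t} {L : latticeType d}.
Implicit Types (x y : L) (p q : J L).

Lemma Jc_sub_J : Jc L `<=` J L.
Proof.
move=> p [pL [s [sp sP]]]; split=> // x y pxy.
apply: contrapT => /not_orP[px py]; suff : p <= s by rewrite (lt_geF sp).
rewrite pxy leUx !sP // lt_neqAle pxy ?leUl ?leUr andbT -pxy.
  by apply/eqP => /esym.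
by apply/eqP => /esym.
Qed.

Lemma is_lower_star_uniq {p s t : L} :
  is_lower_star p s -> is_lower_star p t -> s = t.
Proof. by move=> [sp sP] [tp tP]; apply/le_anti; rewrite sP // tP. Qed.

Hypothesis hchain : forall a b : L, a < b ->
  exists (n : nat) (x : nat -> L),
    [/\ (0 < n)%N, x 0%N = a, x n = b &
        forall i, (i < n)%N -> lessdot (x i) (x i.+1)].

(** The last link of a chain from [p /\ a] to [p], with [p] not below [a], writes [p = q \/ x n]
    with [q] in [Jc L]. Join-irreducibility gives [p = q], since [p = x n] would give [q <= x n] and
    make [q] equal to its meet [s] with [x n]. *)
Lemma J_eq_Jc : J L = Jc L.
Proof.
apply/seteqP; split; last exact: Jc_sub_J.
move=> p [pL pJ]; split=> //.
have [a npa] : exists a, ~ (p <= a).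
  by apply: contrapT => /forallNP/(_ _)/contrapT.
have pap : p `&` a < p.
  rewrite lt_neqAle leIl andbT; apply/eqP => paE.
  by apply: npa; rewrite -paE leIr.
have [[|n] [x [// _ _ xn /(_ n (ltnSn n))]]] := hchain _ _ pap.
rewrite xn => -[_ [q [s [_ [sq sP] [sE pE]]]]].
exists s; case: (pJ _ _ pE) => [->//|xnp].
suff : q <= s by rewrite (lt_geF sq).
by rewrite sE lexI lexx -xnp pE leUl.
Qed.

Context {lower : J L -> L}.
Hypothesis lowerP : forall p, is_lower_star (val p) (lower p).

Definition jump {M : nmodType} (f : interval2 L -> M) p : M :=
  value f (lower p) (val p).

Lemma jumpE {M : nmodType} (f : interval2 L -> M) p :
  jump f p = f (mk2 (ltW (proj1 (lowerP p)))).
Proof. exact: valueE. Qed.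

(** Each link of a chain is transposed from some [[p_*, p]]. The word is found before [M] and [f],
    so the same one serves [Delta] and any other dimension function. *)
Lemma interval_word x y : x <= y -> exists u : seq (J L),
  forall (M : nmodType) (f : interval2 L -> M), dimension_function f ->
    value f x y = (\sum_(p <- u) jump f p)%R.
Proof.
rewrite le_eqVlt => /predU1P[<-|/hchain[n [z [_ <- <- zS]]]].
  by exists [::] => M f f_dim; rewrite big_nil value_refl.
suff /(_ n (leqnn n))[_ //] : forall i, (i <= n)%N -> z 0%N <= z i /\
    exists u : seq (J L), forall (M : nmodType) (f : interval2 L -> M),
      dimension_function f ->
      value f (z 0%N) (z i) = (\sum_(p <- u) jump f p)%R.
elim=> [_|i IH i_n].
  by split=> //; exists [::] => M f f_dim; rewrite big_nil value_refl.
have [z0i [u uE]] := IH (ltnW i_n).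
have [zii [p [s [pJc sP [sE zE]]]]] := zS i i_n.
split; first exact: le_trans z0i zii.
pose p' : J L := SigSub (mem_set (Jc_sub_J _ pJc)).
have lowerE : lower p' = s := is_lower_star_uniq (lowerP p') sP.
exists (p' :: u) => M f f_dim.
rewrite big_cons -uE // (value_add f_dim _ _ _ z0i zii) addrC; congr (_ + _)%R.
by rewrite zE -value_transpose // -sE /jump lowerE.
Qed.

Hypothesis hcover : weak_minimal_join_cover_refinement L.

Lemma jump_Delta p : jump (@Delta d L) p = tilde (@tlt d L) p.
Proof. by rewrite jumpE; apply: Delta_lower_star. Qed.

Lemma generated_range_jump (M : nmodType) (f : interval2 L -> M) :
  dimension_function f -> generated (range f) = generated (range (jump f)).
Proof.
move=> f_dim; apply/seteqP; split; apply: smallest_sub;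
  try exact: submonoid_generated.
  move=> _ [[[x y] /= xy] _ <-]; have [u uE] := interval_word _ _ xy.
  by rewrite generated_words; exists u; rewrite // -uE // (valueE f xy).
move=> _ [p _ <-]; apply: sub_generated.
by rewrite jumpE; eexists.
Qed.

Lemma generated_range_Delta :
  generated (range (@Delta d L)) = E_image (@tlt d L).
Proof.
rewrite generated_range_jump; last exact: Delta_dimension_function.
by rewrite /E_image -(funext jump_Delta).
Qed.

Hypothesis hJSD : join_semidistributive L.

Lemma jump_tlt (M : nmodType) (f : interval2 L -> M) : dimension_function f ->
  forall p q, tlt p q -> (jump f p + jump f q = jump f q)%R.
Proof.
move=> f_dim p q; elim=> {p q} [p q pq|p q r _ pq _ qr].
  exact: (value_join_dep f_dim _ _ _ _ hJSD (lowerP p) (lowerP q) pq).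
by rewrite -qr addrA pq.
Qed.

Lemma jump_word_inj (M : nmodType) (f : interval2 L -> M) (u v : seq (J L)) :
  dimension_function f ->
  (\sum_(p <- u) tilde (@tlt d L) p = \sum_(p <- v) tilde (@tlt d L) p)%R ->
  (\sum_(p <- u) jump f p = \sum_(p <- v) jump f p)%R.
Proof.
by move=> f_dim; apply: tilde_word_inj; apply: jump_tlt.
Qed.

Lemma corestriction_dimension_function (M : nmodType) (f : interval2 L -> M) :
  dimension_function f -> dimension_function (corestriction f).
Proof.
by move=> [f0 fD fIU]; split=> [x|x y z xy yz|x y]; apply: val_inj => /=;
  rewrite ?rmorphD ?raddfD.
Qed.

Lemma val_generated_morphism {M : nmodType} (A : set M) :
  nmod_morphism (val : generated_type A -> M).
Proof. by []. Qed.

(** The jumps of the corestriction generate its target, whence uniqueness. For existence,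
    [jump_word_inj] lets [word_morphism] send them to the jumps of [g], and the common words of
    [interval_word] extend this to all intervals. *)
Lemma Delta_separating : separating (@Delta d L).
Proof.
have Delta_dim := Delta_dimension_function hcover.
have cD_dim := corestriction_dimension_function _ _ Delta_dim.
have cD_jump p : val (jump (corestriction (@Delta d L)) p) =
    tilde (@tlt d L) p.
  by rewrite -jump_Delta !jumpE.
have val_sum :=
  nmod_morphism_sum _ (val_generated_morphism (range (@Delta d L))).
have words (t : generated_type (range (@Delta d L))) : exists u : seq (J L),
    t = (\sum_(p <- u) jump (corestriction (@Delta d L)) p)%R.
  have := set_mem (valP t); rewrite generated_range_jump // generated_words.
  move=> [u _ ux]; exists u; apply: val_inj; rewrite val_sum -ux.
  by apply: eq_bigr => p _; rewrite cD_jump jump_Delta.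
split=> // N g g_dim.
have [u v uv|phi phiM phiE] := word_morphism (b := jump g) words.
  apply: jump_word_inj => //; move/(congr1 val): uv; rewrite !val_sum.
  by under eq_bigr do rewrite cD_jump; under [RHS]eq_bigr do rewrite cD_jump.
exists phi; split=> [|psi [psiM gE]].
  split=> //; apply/funext => -[[x y] /= xy].
  have [u uE] := interval_word _ _ xy.
  rewrite -(valueE g xy) -[in RHS](valueE _ xy) !uE // nmod_morphism_sum //.
  by under [RHS]eq_bigr do rewrite phiE.
apply/funext => t; have [u ->] := words t; rewrite !nmod_morphism_sum //.
by apply: eq_bigr => p _; rewrite phiE gE !jumpE.
Qed.

(** Both monoids are generated by families indexed by [J L], so it suffices that the same equalities
    between words hold in both. *)
Lemma Dim_isomorphic_E : nmod_isomorphic (Dim L) (E (@tlt d L)).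
Proof.
have [gen_dim gen_univ] := Dim_universal L.
pose a := jump (@Dim_gen d L); pose b := @pres_gen _ (E_rel (@tlt d L)).
have b_tlt p q : tlt p q -> (b p + b q = b q)%R.
  move=> pq; have := pres_relE (E_rel_ll pq).
  by rewrite !pres_classE !big_cons big_nil !addr0.
have aM (t : Dim L) : exists u : seq (J L), t = (\sum_(p <- u) a p)%R.
  have : generated (range (@Dim_gen d L)) t.
    rewrite generated_words; exists (repr t)%qT => //=.
    by rewrite -[RHS]pres_classK pres_classE.
  by rewrite generated_range_jump // generated_words => -[u _ <-]; exists u.
have bN (t : E (@tlt d L)) : exists u : seq (J L), t = (\sum_(p <- u) b p)%R.
  by exists (repr t)%qT; rewrite -[LHS]pres_classK pres_classE.
apply: (word_isomorphism aM bN) => u v; split=> uv.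
  (* The homomorphism through which [Delta] factors carries an equality in [Dim L] to the sums of
     the [tilde p], and equal sums there force equal words in [E]. *)
  apply: (tilde_word_inj b_tlt).
  have [phi [[phiM DeltaE] _]] :=
    gen_univ _ _ (Delta_dimension_function hcover).
  have phiE p : phi (a p) = tilde (@tlt d L) p.
    by rewrite -jump_Delta /a !jumpE DeltaE.
  have := congr1 phi uv; rewrite !nmod_morphism_sum //.
  by under eq_bigr do rewrite phiE; under [RHS]eq_bigr do rewrite phiE.
(* Conversely, the jumps in [Dim L] satisfy the defining relations of [E], so a homomorphism from
   [E] carries equalities back. *)
have [|phi [[phiM aE] _]] := @pres_universal _ (E_rel (@tlt d L)) (Dim L) a.
  move=> _ _ [p q pq]; rewrite !big_cons big_nil !addr0.
  exact: jump_tlt.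
by have := congr1 phi uv; rewrite !nmod_morphism_sum // aE.
Qed.

End Chains.

Theorem theorem6p4 (d : Order.disp_t) (L : latticeType d)
    (hcover : weak_minimal_join_cover_refinement L)
    (hchain : forall a b : L, a < b ->
       exists (n : nat) (x : nat -> L),
         [/\ (0 < n)%N, x 0%N = a, x n = b &
             forall i, (i < n)%N -> lessdot (x i) (x i.+1)]) :
  [/\ J L = Jc L,
      generated (range (@Delta d L)) = E_image (@tlt d L) &
      join_semidistributive L ->
        separating (@Delta d L) /\
        nmod_isomorphic (Dim L) (E (@tlt d L))].
Proof.
have JJc := J_eq_Jc hchain.
have /choice[lower lowerP] (p : J L) : exists s, is_lower_star (val p) s.
  by have := set_mem (valP p); rewrite [X in X _]JJc => -[].
split=> // [|hJSD]; first exact: (generated_range_Delta hchain lowerP hcover).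
split; first exact: (Delta_separating hchain lowerP hcover hJSD).
exact: (Dim_isomorphic_E hchain lowerP hcover hJSD).
Qed.
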